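(* Let a snapshot $S$ be given by a set $\{T_1,\ldots,T_m\}$ of $m$ triangles. Then the triangulation $\mathcal{T}_S(S)$ returned by the spatial triangulation algorithm $\mathcal{T}_S$ contains $O(m^2)$ triangles.
   Context: Triangles. A triangle is a closed filled triangle in $\mathbb{R}^2$, given by its three corner points with rational or real algebraic coordinates; it may degenerate to a closed line segment or a point. Snapshots. A snapshot is a subset $S\subseteq\mathbb{R}^2$ given as a finite union of (possibly overlapping, possibly degenerate) triangles. Standing assumption: $S$ is fully two-dimensional, i.e. $S$ equals the union of the nondegenerate triangles in the given set. Algorithm $\mathcal{T}_S$. On input $S$ given by a finite set of triangles: (1) Let $\mathcal{B}(S)$ be the set of those edges of the input triangles that contribute to the boundary of $S$, i.e. that contain a nondegenerate segment of the topological boundary of $S$; also compute the planar subdivision $\mathcal{U}(S)$ induced by the input triangles. (2) Compute the convex hull $\mathcal{CH}(S)$ of all corner points of the input triangles. (3) Compute the subdivision of $\mathcal{CH}(S)$ (used as bounding box) induced by all lines through the segments of $\mathcal{B}(S)$; its faces are convex polygons. (4) For each face with vertices $v_1,\ldots,v_c$ in cyclic order, compute $a=\frac1c\sum_{i=1}^c v_i$; if $a$ belongs to $S$ (i.e. to a face of $\mathcal{U}(S)$ contained in $S$), output the $c$ closed triangles with corner points $a,v_i,v_{i+1}$ ($i=1,\ldots,c$, with $v_{c+1}=v_1$). The output is the set of all triangles so produced, denoted $\mathcal{T}_S(S)$. The constant in $O(\cdot)$ is absolute. *)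

(* Defs.v *)
From HB Require Import structures.
From mathcomp Require Import all_boot all_order all_algebra finmap.
From mathcomp Require Import all_classical all_reals all_analysis.
Set Implicit Arguments.
Unset Strict Implicit.
Unset Printing Implicit Defensive.
Import Order.TTheory GRing.Theory Num.Theory.
Import numFieldNormedType.Exports.
Local Open Scope classical_set_scope.
Local Open Scope ring_scope.

(* The regular algebra R^o makes the product a normed R-module. *)
Notation plane R := (R^o * R^o)%type.

(* A triangle is presented by its three corner points. *)
Notation triangle R := (plane R * plane R * plane R)%type.

Section Geometry.
Context {R : realType}.
Implicit Types (p q r x : plane R) (t : triangle R) (A : set (plane R)).

Definition algebraic_point p :=
  algebraicOver (ratr : rat -> R) p.1 /\ algebraicOver (ratr : rat -> R) p.2.

Definition hull A : set (plane R) := smallest (@convex_set R (plane R)) A.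

Definition segment p q : set (plane R) := hull [set p; q].

Definition boundary A : set (plane R) := closure A `\` A°.

(* Twice the signed area of p q r: positive iff p, q, r turn counterclockwise,
   zero iff they are collinear. *)
Definition orient p q r : R :=
  (q.1 - p.1) * (r.2 - p.2) - (q.2 - p.2) * (r.1 - p.1).

(* This is a line only when p != q. *)
Definition line p q : set (plane R) := [set x | orient p q x = 0].

Definition corners t : seq (plane R) := [:: t.1.1; t.1.2; t.2].

Definition edges t : seq (plane R * plane R) :=
  [:: (t.1.1, t.1.2); (t.1.2, t.2); (t.2, t.1.1)].

Definition filled t : set (plane R) := hull [set` corners t].

Definition nondegenerate t : Prop := orient t.1.1 t.1.2 t.2 != 0.

End Geometry.

Section SpatialTriangulation.
Context {R : realType}.
Implicit Types (T : {fset triangle R}) (F : set (plane R)).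

Definition snapshot T : set (plane R) := \bigcup_(t in [set` T]) filled t.

Definition fully_two_dimensional T : Prop :=
  snapshot T = \bigcup_(t in [set t | t \in T /\ nondegenerate t]) filled t.

Definition boundary_edges T : set (plane R * plane R) :=
  [set e | (exists2 t, t \in T & e \in edges t) /\
    exists x y, x != y /\
      segment x y `<=` segment e.1 e.2 `&` boundary (snapshot T)].

Definition bounding_hull T : set (plane R) :=
  hull (\bigcup_(t in [set` T]) [set` corners t]).

Definition subdivision_lines T : set (plane R) :=
  \bigcup_(e in boundary_edges T) line e.1 e.2.

(* Faces are open; the corresponding convex polygons are their closures. *)
Definition faces T : set (set (plane R)) :=
  let U := (bounding_hull T)° `\` subdivision_lines T in
  [set connected_component U x | x in U].

(* v lists counterclockwise the vertices of the convex polygon closure F: every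
   other vertex is strictly to the left of each directed edge v_i v_(i+1), with
   indices taken modulo c. The enumeration is unique up to rotation. *)
Definition cyclic_vertices F c (v : 'I_c -> plane R) : Prop :=
  [/\ (3 <= c)%N, closure F = hull (range v) &
    forall i j : 'I_c, j != i -> j != ordS i ->
      0 < orient (v i) (v (ordS i)) (v j)].

Definition barycenter c (v : 'I_c -> plane R) : plane R :=
  c%:R^-1 *: \sum_(i < c) v i.

(* The counterclockwise convention makes each output triangle appear as exactly
   one triple of corners. *)
Definition spatial_triangulation T : set (triangle R) :=
  [set t | exists F c (v : 'I_c -> plane R) (i : 'I_c),
    [/\ faces T F, cyclic_vertices F v, snapshot T (barycenter v) &
        t = (barycenter v, v i, v (ordS i))]].

End SpatialTriangulation.

(* Main.v *)
Require Import Defs.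
From mathcomp Require Import all_boot all_order all_algebra finmap.
From mathcomp Require Import all_classical all_reals all_analysis.
From mathcomp Require Import ring lra zify.
Set Implicit Arguments.
Unset Strict Implicit.
Unset Printing Implicit Defensive.
Import Order.TTheory GRing.Theory Num.Theory.
Import numFieldNormedType.Exports.
Local Open Scope classical_set_scope.
Local Open Scope ring_scope.

(* The sides of the faces lie on few lines: a side of a face either lies on a
   subdivision line, or all corner points lie on one side of its line, which
   then passes through two corners; a corner p starts at most one line through
   two corners that supports the corner set. This gives at most 3m + 3m lines.
   An output triangle (a, v_i, v_(i+1)) is determined by the line of the side
   v_i v_(i+1), the line of the preceding side (which cuts out v_i), and the
   direction of the side along its line: faces lying to the left of overlapping
   rays from a common vertex overlap, hence coincide, and a face determines its
   vertices. So there are at most 2 (6m)^2 output triangles. *)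

(** An element may carry several labels and a label may name nothing; it is enough that no label
    names two elements. Then [A] is covered by the image of [s], idle labels being sent to a default
    [x0]. *)
Lemma card_le_labels (X : choiceType) (Y : eqType) (A : set X) (s : seq Y)
    (Q : Y -> X -> Prop) :
  (forall x, A x -> exists2 y, y \in s & Q y x) ->
  (forall y x x', Q y x -> Q y x' -> x = x') ->
  finite_set A /\ (#|` fset_set A| <= size s)%N.
Proof.
move=> AQ Q1; have [->|/set0P[x0 _]] := eqVneq A set0.
  by split; [exact: finite_set0|rewrite fset_set0 cardfs0].
pose g y := xget x0 [set x | Q y x].
have Ag x : A x -> x \in map g s.
  move=> Ax; have [y ys Qyx] := AQ x Ax; apply/mapP; exists y => //.
  rewrite /g; case: xgetP => [x' _ Qyx'|/(_ x)//]; exact: Q1 Qyx Qyx'.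
have finA : finite_set A by apply: sub_finite_set (finite_seq (map g s)) => x /Ag.
split => //; rewrite -(size_map g); apply: uniq_leq_size; first exact: fset_uniq.
by move=> x; rewrite in_fset_set// inE => /Ag.
Qed.

Section Geometry.
Context {R : realType}.
Implicit Types (p q r x y z : plane R) (A B : set (plane R)) (a b c : R).

(** * Convex hulls *)

Lemma convex_setP A : @convex_set R (plane R) A <->
  (forall x y a b, A x -> A y -> 0 <= a -> 0 <= b -> a + b = 1 ->
     A (a *: x + b *: y)).
Proof.
split=> [cA x y a b Ax Ay a0 b0 ab|cA x y l].
  have a1 : a <= 1 by lra.
  have := cA x y (Itv01 a0 a1); rewrite !inE => /(_ Ax Ay).
  by have -> : b = 1 - a by lra.
rewrite !inE => Ax Ay; apply: cA => //.
- by rewrite subr_ge0.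
- by rewrite addrC subrK.
Qed.

Lemma orient_conv p q x y a b : a + b = 1 ->
  orient p q (a *: x + b *: y) = a * orient p q x + b * orient p q y.
Proof.
move=> ab; rewrite /orient /=.
have -> : a = 1 - b by lra.
rewrite /GRing.scale /=.
ring.
Qed.

Lemma hull_conv A x y a b : hull A x -> hull A y ->
  0 <= a -> 0 <= b -> a + b = 1 -> hull A (a *: x + b *: y).
Proof.
move=> Ax Ay a0 b0 ab B [/[dup] cB /convex_setP B2 AB].
by apply: B2 => //; [exact: Ax|exact: Ay].
Qed.

Lemma hull_sub A B : A `<=` B ->
  (forall x y a b, B x -> B y -> 0 <= a -> 0 <= b -> a + b = 1 ->
     B (a *: x + b *: y)) -> hull A `<=` B.
Proof. by move=> AB cB; apply: smallest_sub => //; apply/convex_setP. Qed.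

Lemma sub_hull A : A `<=` hull A.
Proof. exact: sub_gen_smallest. Qed.

Lemma hull_orient_ge0 A p q : (forall x, A x -> 0 <= orient p q x) ->
  forall x, hull A x -> 0 <= orient p q x.
Proof.
move=> A0; apply: hull_sub => // x y a b x0 y0 a0 b0 ab.
by rewrite orient_conv// addr_ge0// mulr_ge0.
Qed.

Lemma hull_set0 : hull (set0 : set (plane R)) = set0.
Proof. by apply/seteqP; split=> //; apply: hull_sub. Qed.

Lemma hull_set1 p : hull [set p] = [set p].
Proof.
apply/seteqP; split; last exact: sub_hull.
by apply: hull_sub => // x y a b /= -> -> _ _ ab; rewrite -scalerDl ab scale1r.
Qed.

(** A convex combination of two points of the cone regroups into a share of [p] and a share of
    [hull A]. For empty [A] the cone would be empty and miss [p]. *)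
Lemma hull_cone p A : A !=set0 -> hull (p |` A) =
  [set ((1 - u.1) *: p + u.1 *: u.2)%R | u in (`[0, 1] `*` hull A)].
Proof.
move=> [y0 Ay0]; apply/seteqP; split; last first.
  move=> _ [[t y] /= [/itvP t01 Ay] <-].
  apply: hull_conv; rewrite ?subr_ge0 ?t01 ?subrK//.
    by apply: sub_hull; left.
  by apply: hull_sub Ay; [move=> z Az; apply: sub_hull; right|exact: hull_conv].
apply: hull_sub => [x [->|Ax]|].
- exists (0, y0) => /=; last by rewrite subr0 scale1r scale0r addr0.
  by split; [rewrite in_itv/= lexx ler01|exact: sub_hull].
- exists (1, x) => /=; last by rewrite subrr scale1r scale0r add0r.
  by split; [rewrite in_itv/= lexx ler01|exact: sub_hull].
move=> _ _ a b [[s x] /= [/itvP s01 Ax] <-] [[t y] /= [/itvP t01 Ay] <-].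
(* [w] is the total weight that the combination gives to [hull A]; the point of [hull A] is obtained
   by dividing by [w], so [w = 0] is treated apart. *)
move=> a0 b0 ab; set w := a * s + b * t.
have as0 : 0 <= a * s by rewrite mulr_ge0// s01.
have bt0 : 0 <= b * t by rewrite mulr_ge0// t01.
have w0 : 0 <= w by rewrite addr_ge0.
have w1 : w <= 1.
  by rewrite -ab lerD// -[leRHS]mulr1 ler_wpM2l// ?s01 ?t01.
have pE u v : a *: ((1 - s) *: p + s *: u) + b *: ((1 - t) *: p + t *: v) =
    (1 - w) *: p + ((a * s) *: u + (b * t) *: v).
  rewrite /w (_ : a = 1 - b); last by lra.
  case: p u v => [p1 p2] [u1 u2] [v1 v2].
  by congr pair; rewrite /= /GRing.scale /=; ring.
have [w00|wn0] := eqVneq w 0.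
  exists (0, x) => /=; first by rewrite in_itv/= lexx ler01.
  have [as00 bt00] : a * s = 0 /\ b * t = 0 by rewrite /w in w00; split; lra.
  by rewrite pE w00 as00 bt00 !scale0r !addr0.
exists (w, ((a * s) / w) *: x + ((b * t) / w) *: y) => /=.
  split; first by rewrite in_itv/= w0.
  by apply: hull_conv => //; rewrite ?divr_ge0// -mulrDl divff.
by rewrite pE scalerDr !scalerA !(mulrC w) !divfK.
Qed.

(** Induction on the list: by [hull_cone] each hull is a continuous image of the unit interval times
    the previous hull. *)
Lemma hull_seq_compact (s : seq (plane R)) : compact (hull [set` s]).
Proof.
case: s => [|p s]; first by rewrite set_nil hull_set0; exact: compact0.
elim: s p => [|q s IH] p.
  by rewrite set_cons1 hull_set1; exact: compact_set1.
have -> : [set` p :: q :: s] = p |` [set` q :: s].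
  apply/seteqP; split=> x /=; first by rewrite in_cons => /orP[/eqP|]; [left|right].
  by rewrite (in_cons p) => -[->|->]; rewrite ?eqxx ?orbT.
rewrite hull_cone; last by exists q; rewrite /= mem_head.
apply: continuous_compact; last by apply: compact_setX => //; exact: segment_compact.
apply: continuous_subspaceT => u.
apply: cvgD; apply: cvgZ.
- by apply: cvgB; [exact: cvg_cst|exact: cvg_fst].
- exact: cvg_cst.
- exact: cvg_fst.
- exact: cvg_snd.
Qed.

Lemma hull_seq_closed (s : seq (plane R)) : closed (hull [set` s]).
Proof.
by apply: compact_closed; [exact: norm_hausdorff|exact: hull_seq_compact].
Qed.

(** The set is a union of segments issuing from one of its points. *)
Lemma convex_connected A : @convex_set R (plane R) A -> connected A.
Proof.
move=> /convex_setP cA.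
have [->|/set0P[x Ax]] := eqVneq A set0; first exact: connected0.
pose seg y := (fun t => (1 - t) *: x + t *: y) @` `[0, 1].
have -> : A = \bigcup_(y in A) seg y.
  apply/seteqP; split=> [y Ay|_ [y Ay [t /itvP t01 <-]]].
    exists y => //; exists 1; first by rewrite /= in_itv/= lexx ler01.
    by rewrite subrr scale0r add0r scale1r.
  by apply: cA; rewrite ?subr_ge0 ?t01 ?subrK.
apply: bigcup_connected.
  exists x => y Ay; exists 0; first by rewrite /= in_itv/= lexx ler01.
  by rewrite subr0 scale0r addr0 scale1r.
move=> y Ay; apply: connected_continuous_connected.
  exact: segment_connected.
apply: continuous_subspaceT => t.
apply: cvgD; apply: cvgZ.
- by apply: cvgB; [exact: cvg_cst|exact: cvg_id].
- exact: cvg_cst.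
- exact: cvg_id.
- exact: cvg_cst.
Qed.

(** A convex neighbourhood of [y] inside [A] is connected and meets the component, hence lies in
    it. *)
Lemma component_nbhs A x y : open A -> A y ->
  closure (connected_component A x) y -> nbhs y (connected_component A x).
Proof.
move=> oA Ay clF.
have [B cB [oB bB]] := @locally_convex R (plane R).
have /bB[N [BN Ny] NA] : nbhs y A by exact: open_nbhs_nbhs.
have nN : nbhs y N by apply: open_nbhs_nbhs; split => //; exact: oB.
have [z [Fz Nz]] := clF N nN.
apply: filterS nN => w Nw.
apply: connected_component_trans Fz _.
apply: (connected_component_max Nz NA) => //.
by apply: convex_connected; apply: cB; rewrite inE.
Qed.

(** * Orientation and triangles *)

Lemma continuous_orient p q : continuous (orient p q : plane R -> R^o).
Proof.
move=> x; apply: cvgB; apply: cvgM; first [exact: cvg_cst|apply: cvgB].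
- exact: cvg_snd.
- exact: cvg_cst.
- exact: cvg_fst.
- exact: cvg_cst.
Qed.

Lemma open_orient_gt0 p q : open [set x | 0 < orient p q x].
Proof.
apply: (@open_comp _ _ (orient p q : plane R -> R^o) [set y | 0 < y]).
  by move=> x _; exact: continuous_orient.
exact: open_gt.
Qed.

Lemma nbhs_orient_gt0 p q x : 0 < orient p q x ->
  nbhs x [set y | 0 < orient p q y].
Proof.
by move=> x0; apply: open_nbhs_nbhs; split=> //; exact: open_orient_gt0.
Qed.

Lemma closed_line p q : closed (line p q).
Proof.
apply: (@closed_comp _ _ (orient p q : plane R -> R^o) [set y | y = 0]).
  by move=> x _; exact: continuous_orient.
exact: closed_eq.
Qed.

(** The three orientations sum to [orient p q r], so this set is empty unless [p], [q], [r] turn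
    counterclockwise. *)
Definition open_triangle p q r : set (plane R) :=
  [set x | [/\ 0 < orient p q x, 0 < orient q r x & 0 < orient r p x]].

Lemma nbhs_open_triangle p q r x : open_triangle p q r x ->
  nbhs x (open_triangle p q r).
Proof.
move=> [x1 x2 x3].
apply: filterS (filterI (nbhs_orient_gt0 x1)
  (filterI (nbhs_orient_gt0 x2) (nbhs_orient_gt0 x3))) => y.
by move=> [? []].
Qed.

(** The three orientations, divided by their sum, are the barycentric coordinates of [x]. They are
    applied in two stages because [hull_conv] combines two points at a time. *)
Lemma open_triangle_hull A p q r :
  hull A p -> hull A q -> hull A r -> open_triangle p q r `<=` hull A.
Proof.
move=> Ap Aq Ar x [x1 x2 x3].
set u := orient p q x in x1; set v := orient q r x in x2.
set w := orient r p x in x3.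
have vw0 : 0 < v + w by rewrite addr_gt0.
have uvw0 : 0 < u + (v + w) by rewrite addr_gt0.
have -> : x = (u / (u + (v + w))) *: r + ((v + w) / (u + (v + w))) *:
              ((v / (v + w)) *: p + (w / (v + w)) *: q).
  have [e1 e2] : (u + (v + w)) * x.1 = u * r.1 + v * p.1 + w * q.1 /\
                 (u + (v + w)) * x.2 = u * r.2 + v * p.2 + w * q.2.
    by rewrite /u /v /w /orient; split; ring.
  have n1 := lt0r_neq0 vw0; have n2 := lt0r_neq0 uvw0.
  move: u v w x1 x2 x3 vw0 uvw0 e1 e2 n1 n2 => u v w _ _ _ _ _ e1 e2 n1 n2.
  rewrite [LHS]surjective_pairing; congr pair; rewrite /= /GRing.scale /=.
    by apply: (mulfI n2); rewrite e1; field; rewrite n1.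
  by apply: (mulfI n2); rewrite e2; field; rewrite n1.
apply: hull_conv => //.
- by apply: hull_conv => //; rewrite ?divr_ge0 ?ltW// -mulrDl divff ?lt0r_neq0.
- by rewrite divr_ge0 ?ltW.
- by rewrite divr_ge0 ?ltW.
- by rewrite -mulrDl divff ?lt0r_neq0.
Qed.

(** A pair holds the constant term and the slope of an affine function. Finitely many such functions
    that are positive at 0 stay positive on a common interval. *)
Lemma affine_gt0 (s : seq (R * R)) : (forall u, u \in s -> 0 < u.1) ->
  exists2 e, 0 < e & forall u t, u \in s -> 0 < t <= e -> 0 < u.1 + u.2 * t.
Proof.
elim: s => [_|w s IH s0]; first by exists 1.
have [u us|e e0 eP] := IH; first by apply: s0; rewrite in_cons us orbT.
have w0 : 0 < w.1 by apply: s0; exact: mem_head.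
have w2 : 0 < 1 + `|w.2| by rewrite ltr_pwDl.
(* For [t] below the second bound, [w.1 - |w.2| * t >= t > 0]; the added 1 also avoids a zero
   denominator. *)
exists (Num.min e (w.1 / (1 + `|w.2|))); first by rewrite lt_min e0 divr_gt0.
move=> u t + /andP[t0]; rewrite le_min in_cons => + /andP[te].
case/orP=> [/eqP ->|us _]; last by apply: eP => //; rewrite t0.
rewrite ler_pdivlMr// => tw.
have : - `|w.2| * t <= w.2 * t by rewrite ler_pM2r// lerNl -normrN ler_norm.
nra.
Qed.

(** Both triangles lie to the left of the same ray from [p]. A point of that ray before both [q] and
    [q'], pushed slightly towards [r], is in both. *)
Lemma open_triangles_overlap p q q' r r' c : 0 < c -> q' = p + c *: (q - p) ->
  0 < orient p q r -> 0 < orient p q' r' ->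
  exists x, open_triangle p q r x /\ open_triangle p q' r' x.
Proof.
move=> c0 q'E D0 D'0.
have E0 : 0 < orient p q r'.
  have : orient p q' r' = c * orient p q r'.
    by rewrite q'E /orient /= /GRing.scale /=; ring.
  by move=> D'E; rewrite D'E pmulr_rgt0 in D'0.
have [s [s0 s1 sc]] : exists s, [/\ 0 < s, s < 1 & s < c].
  exists (Num.min 1 c / 2); have m0 : 0 < Num.min 1 c by rewrite lt_min ltr01.
  have : Num.min 1 c <= 1 by rewrite ge_min lexx.
  have : Num.min 1 c <= c by rewrite ge_min lexx orbT.
  by split; lra.
(* [C] is the rate at which [orient q' r'] changes as the point moves in the direction [r - p]. The
   three pairs below are the conditions that hold only for a small push [t]. *)
pose C := (r'.1 - q'.1) * (r.2 - p.2) - (r'.2 - q'.2) * (r.1 - p.1).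
have [|t t0 tP] := @affine_gt0 [:: (1 - s, -1);
    (s * orient p q r', orient r' p r); ((c - s) * orient p q r', C)].
  move=> u; rewrite !inE => /or3P[] /eqP -> /=; first by rewrite subr_gt0.
    exact: mulr_gt0.
  by rewrite mulr_gt0// subr_gt0.
have tt : 0 < t <= t by rewrite t0 lexx.
have t1 : 0 < 1 - s + -1 * t by apply: (tP (_, _)); rewrite ?inE ?eqxx.
have t2 : 0 < s * orient p q r' + orient r' p r * t.
  by apply: (tP (_, _)); rewrite ?inE ?eqxx ?orbT.
have t3 : 0 < (c - s) * orient p q r' + C * t.
  by apply: (tP (_, _)); rewrite ?inE ?eqxx ?orbT.
(* The point has barycentric coordinates (1 - s - t, s, t) in p, q, r. *)
exists (p + s *: (q - p) + t *: (r - p)); split; split.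
- suff -> : orient p q (p + s *: (q - p) + t *: (r - p)) = t * orient p q r.
    exact: mulr_gt0.
  by rewrite /orient /= /GRing.scale /=; ring.
- suff -> : orient q r (p + s *: (q - p) + t *: (r - p)) =
      (1 - s + -1 * t) * orient p q r by exact: mulr_gt0.
  by rewrite /orient /= /GRing.scale /=; ring.
- suff -> : orient r p (p + s *: (q - p) + t *: (r - p)) =
      s * orient p q r by exact: mulr_gt0.
  by rewrite /orient /= /GRing.scale /=; ring.
- suff -> : orient p q' (p + s *: (q - p) + t *: (r - p)) =
      c * t * orient p q r by rewrite !mulr_gt0.
  by rewrite q'E /orient /= /GRing.scale /=; ring.
- suff -> : orient q' r' (p + s *: (q - p) + t *: (r - p)) =
      (c - s) * orient p q r' + C * t by [].
  by rewrite /C q'E /orient /= /GRing.scale /=; ring.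
- suff -> : orient r' p (p + s *: (q - p) + t *: (r - p)) =
      s * orient p q r' + orient r' p r * t by [].
  by rewrite /orient /= /GRing.scale /=; ring.
Qed.

Lemma on_lineP p q x : p != q -> orient p q x = 0 ->
  exists c, x = p + c *: (q - p).
Proof.
move=> pq x0; pose d := (q.1 - p.1) ^+ 2 + (q.2 - p.2) ^+ 2.
have d0 : d != 0.
  apply: contra pq; rewrite paddr_eq0 ?sqr_ge0// !sqrf_eq0 !subr_eq0.
  by case: p q {d x0} => [p1 p2] [q1 q2] /= /andP[/eqP -> /eqP ->].
(* The coefficient of the orthogonal projection of [x - p] onto [q - p], whose squared length is
   [d]. *)
exists (((x.1 - p.1) * (q.1 - p.1) + (x.2 - p.2) * (q.2 - p.2)) / d).
have xE (e : R) : e * d = (x.1 - p.1) * (q.1 - p.1) + (x.2 - p.2) * (q.2 - p.2) ->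
    x.1 = p.1 + e * (q.1 - p.1) /\ x.2 = p.2 + e * (q.2 - p.2).
  move=> ed; move: x0; rewrite /orient => x0.
  split; apply: (mulfI d0); apply/eqP; rewrite -subr_eq0 mulrDr mulrA (mulrC d e) ed.
    by rewrite -(mulr0 (- (q.2 - p.2))) -x0 /d; apply/eqP; ring.
  by rewrite -(mulr0 (q.1 - p.1)) -x0 /d; apply/eqP; ring.
have [] := xE (((x.1 - p.1) * (q.1 - p.1) + (x.2 - p.2) * (q.2 - p.2)) / d).
  by rewrite divfK.
move=> e1 e2; rewrite [LHS]surjective_pairing.
by congr pair; [rewrite {1}e1|rewrite {1}e2].
Qed.

Lemma notin_itv01 (s : seq R) : exists2 t, 0 < t < 1 & t \notin s.
Proof.
apply: contrapT => noT.
(* The distinct numbers 1/2, 1/3, ... in the open interval, one more than [s] has entries. *)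
pose l := [seq (k.+2%:R : R)^-1 | k <- iota 0 (size s).+1].
have ul : uniq l.
  rewrite map_inj_uniq ?iota_uniq// => i j /invr_inj /eqP.
  by rewrite eqr_nat => /eqP[].
have /(uniq_leq_size ul) : {subset l <= s}.
  move=> _ /mapP[k _ ->]; apply: contrapT => /negP ks; apply: noT.
  exists k.+2%:R^-1 => //; rewrite invr_gt0 ltr0n /=.
  by rewrite invf_lt1 ?ltr0n// ltr1n.
by rewrite size_map size_iota ltnn.
Qed.

(** A line that does not contain both [p] and [q] excludes at most one parameter [t], and only
    finitely many lines are given. The hypothesis also rules out degenerate pairs, whose [orient]
    vanishes everywhere. *)
Lemma generic_point p q (s : seq (plane R * plane R)) :
  (forall e, e \in s -> orient e.1 e.2 p = 0 -> orient e.1 e.2 q != 0) ->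
  exists2 t, 0 < t < 1 &
    forall e, e \in s -> orient e.1 e.2 ((1 - t) *: p + t *: q) != 0.
Proof.
(* The parameter at which the line of [e] crosses the line [p q]. When the denominator is 0 this
   value means nothing, but then vanishing at [t] would force vanishing at both [p] and [q]. *)
move=> spq; pose f (e : plane R * plane R) : R :=
  orient e.1 e.2 p / (orient e.1 e.2 p - orient e.1 e.2 q).
have [t t01 ts] := notin_itv01 (map f s); exists t => // e es.
rewrite orient_conv ?subrK//; apply: contra ts => /eqP e0.
apply/mapP; exists e => //; rewrite /f.
have e1 : t * (orient e.1 e.2 p - orient e.1 e.2 q) = orient e.1 e.2 p by lra.
have [d0|d0] := eqVneq (orient e.1 e.2 p - orient e.1 e.2 q) 0; last first.
  by rewrite -{1}e1 mulfK.
have p0 : orient e.1 e.2 p = 0 by rewrite -e1 d0 mulr0.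
have q0 : orient e.1 e.2 q = 0.
  by move: d0; rewrite p0 sub0r => /eqP; rewrite oppr_eq0 => /eqP.
by have := spq e es p0; rewrite q0 eqxx.
Qed.

Lemma nbhs_shift A x y : nbhs x A -> exists2 e, 0 < e & A (x + e *: y).
Proof.
move=> xA; have cf : (fun e : R => x + e *: y) @ (0 : R) --> x.
  rewrite -[in X in _ --> X](addr0 x) -(scale0r y).
  by apply: cvgD; [exact: cvg_cst|apply: cvgZ; [exact: cvg_id|exact: cvg_cst]].
have /nbhs_ballP[e /= e0 eA] := cf _ xA.
exists (e / 2); first by rewrite divr_gt0.
by apply: eA; rewrite /ball /= sub0r normrN gtr0_norm ?divr_gt0//; lra.
Qed.

(** The homothety [g] with centre [r] and ratio [1 + e] is continuous, and [z] lies between [r] and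
    [g z]; so [z] is in the hull whenever [g z] is. *)
Lemma hull_expand_nbhs A r x e : hull A r -> 0 < e ->
  nbhs (x + e *: (x - r)) (hull A) -> nbhs x (hull A).
Proof.
move=> Ar e0 nA; pose g z := z + e *: (z - r).
have cg : g @ x --> g x.
  apply: cvgD; first exact: cvg_id.
  by apply: cvgZ; [exact: cvg_cst|apply: cvgB; [exact: cvg_id|exact: cvg_cst]].
have : nbhs x (g @^-1` hull A) := cg _ nA.
apply: filterS => z /= Az.
have e1 : 0 < 1 + e by rewrite addr_gt0.
have -> : z = (1 + e)^-1 *: g z + (e / (1 + e)) *: r.
  rewrite /g [LHS]surjective_pairing; congr pair; rewrite /= /GRing.scale /=.
    by field; rewrite lt0r_neq0.
  by field; rewrite lt0r_neq0.
apply: hull_conv => //; first by rewrite invr_ge0 ltW.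
  by rewrite divr_ge0 ?ltW.
by rewrite -{1}[_^-1]mul1r -mulrDl divff ?lt0r_neq0.
Qed.

(** The alternative passes to convex combinations: any positive share of a strictly left point makes
    the result strictly left. *)
Lemma hull_face A p q y p0 : (forall x, A x -> 0 < orient p q x \/ x = p0) ->
  0 <= orient p q p0 -> hull A y -> 0 < orient p q y \/ y = p0.
Proof.
move=> Apos p00; move: y; apply: hull_sub => // x y a b xP yP a0 b0 ab.
have x0 : 0 <= orient p q x by case: xP => [/ltW//|->].
have y0 : 0 <= orient p q y by case: yP => [/ltW//|->].
have [a00|an0] := eqVneq a 0.
  have b1 : b = 1 by lra.
  by rewrite a00 b1 scale0r add0r scale1r.
have [b00|bn0] := eqVneq b 0.
  have a1 : a = 1 by lra.
  by rewrite b00 a1 scale0r addr0 scale1r.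
have {an0 a0}a0 : 0 < a by rewrite lt_neqAle eq_sym an0.
have {bn0 b0}b0 : 0 < b by rewrite lt_neqAle eq_sym bn0.
rewrite orient_conv//.
case: xP => [xp|->]; first by left; rewrite ltr_pwDl ?mulr_gt0// mulr_ge0// ltW.
case: yP => [yp|->]; last by right; rewrite -scalerDl ab scale1r.
by left; rewrite ltr_wpDl ?mulr_gt0// mulr_ge0// ltW.
Qed.

Lemma orient_base1 p q : orient p q p = 0. Proof. by rewrite /orient; ring. Qed.
Lemma orient_base2 p q : orient p q q = 0. Proof. by rewrite /orient; ring. Qed.

(** If at most one point of [A] were on the supporting line [p q], the hull would meet the line in
    at most one point, against [p != q]. Two points of [A] on it, ordered as [p] and [q] are, give
    the pair. *)
Lemma hull_supporting_pair A p q : p != q -> hull A p -> hull A q ->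
  (forall x, A x -> 0 <= orient p q x) ->
  exists a b : plane R, [/\ A a, A b, a != b &
    [/\ (forall x, A x -> 0 <= orient a b x),
        orient a b p = 0 & orient a b q = 0]].
Proof.
move=> pq Ap Aq A0.
suff [a [b [Aa Ab ab a0 b0]]] : exists a b : plane R,
    [/\ A a, A b, a != b, orient p q a = 0 & orient p q b = 0].
  have [c ac] := on_lineP pq a0; have [d bd] := on_lineP pq b0.
  have oE u v x : orient (p + u *: (q - p)) (p + v *: (q - p)) x =
      (v - u) * orient p q x.
    by rewrite /orient /= /GRing.scale /=; ring.
  have cd : c != d by apply: contra ab => /eqP cd; rewrite ac bd cd.
  have oE0 u v : orient (p + u *: (q - p)) (p + v *: (q - p)) p = 0 /\
      orient (p + u *: (q - p)) (p + v *: (q - p)) q = 0.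
    by rewrite !oE orient_base1 orient_base2 mulr0.
  case: (ltgtP c d) cd => // cd _.
    exists a, b; split => //; rewrite ac bd.
    split; [|exact: (oE0 _ _).1|exact: (oE0 _ _).2].
    by move=> x Ax; rewrite oE mulr_ge0 ?A0// subr_ge0 ltW.
  exists b, a; split => //; first by rewrite eq_sym.
  rewrite ac bd; split; [|exact: (oE0 _ _).1|exact: (oE0 _ _).2].
  by move=> x Ax; rewrite oE mulr_ge0 ?A0// subr_ge0 ltW.
apply: contrapT => noab.
have [p0 p00 Ap0] : exists2 p0, orient p q p0 = 0 &
    forall x, A x -> 0 < orient p q x \/ x = p0.
  have [[p0 [Ap0 p00]]|nop0] := pselect (exists p0, A p0 /\ orient p q p0 = 0).
    exists p0 => // x Ax; have [xp|xp] := eqVneq x p0; [by right|left].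
    rewrite lt_neqAle A0// andbT eq_sym; apply/eqP => x0.
    by apply: noab; exists x, p0; split.
  (* With no point of [A] on the line, any point of the line can serve as [p0]. *)
  exists p; first exact: orient_base1.
  move=> x Ax; left; rewrite lt_neqAle A0// andbT eq_sym; apply/eqP => x0.
  by apply: nop0; exists x.
have p00' : 0 <= orient p q p0 by rewrite p00.
have [|pp0] := hull_face Ap0 p00' Ap; first by rewrite orient_base1 ltxx.
have [|qp0] := hull_face Ap0 p00' Aq; first by rewrite orient_base2 ltxx.
by rewrite pp0 qp0 eqxx in pq.
Qed.

(** * Convex polygons *)

Lemma orient_swap p q r : orient p r q = - orient p q r.
Proof. by rewrite /orient; ring. Qed.

(** Cramer's rule for [x - q], with determinant [orient p q r]. *)
Lemma two_linesP p q r x : orient p q r != 0 ->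
  orient p q x = 0 -> orient q r x = 0 -> x = q.
Proof.
move=> D0 x1 x2; rewrite [LHS]surjective_pairing [RHS]surjective_pairing.
congr pair; apply: (mulfI D0); apply/eqP; rewrite -subr_eq0; apply/eqP.
  rewrite (_ : _ - _ = (r.1 - q.1) * orient p q x - (q.1 - p.1) * orient q r x).
    by rewrite x1 x2 !mulr0 subrr.
  by rewrite /orient; ring.
rewrite (_ : _ - _ = (r.2 - q.2) * orient p q x - (q.2 - p.2) * orient q r x).
  by rewrite x1 x2 !mulr0 subrr.
by rewrite /orient; ring.
Qed.

Lemma line_collinear p q x y z : p != q -> orient p q x = 0 ->
  orient p q y = 0 -> orient p q z = 0 -> orient x y z = 0.
Proof.
move=> pq /(on_lineP pq)[a ->] /(on_lineP pq)[b ->] /(on_lineP pq)[c ->].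
by rewrite /orient /= /GRing.scale /=; ring.
Qed.

Lemma ordS_neq n (i : 'I_n) : (3 <= n)%N -> ordS i != i /\ ordS (ordS i) != i.
Proof.
move=> n3; have i_n := ltn_ord i.
have mE k : (k < n)%N -> (k.+1 %% n = if k.+1 == n then 0 else k.+1)%N.
  move=> kn; case: eqP => [->|/eqP k1]; first exact: modnn.
  by rewrite modn_small// ltn_neqAle k1.
split; apply/eqP => /(congr1 val) /=; rewrite (mE i)//.
  by case: eqP; lia.
have [i1|i1] := eqVneq i.+1 n.
  by rewrite mE; [case: eqP; lia|lia].
by rewrite mE; [case: eqP; lia|lia].
Qed.

Section Cyclic.
Variables (F : set (plane R)) (n : nat) (v : 'I_n -> plane R).
Hypothesis Fv : cyclic_vertices F v.

Let n3 : (3 <= n)%N. Proof. by case: Fv. Qed.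

Lemma cyclic_closure : closure F = hull (range v). Proof. by case: Fv. Qed.

Lemma cyclic_vertex_closure i : closure F (v i).
Proof. by rewrite cyclic_closure; apply: sub_hull; exists i. Qed.

Lemma cyclic_gt0 i j : j != i -> j != ordS i ->
  0 < orient (v i) (v (ordS i)) (v j).
Proof. by case: Fv => _ _; exact. Qed.

Lemma cyclic_next_gt0 i : 0 < orient (v i) (v (ordS i)) (v (ordS (ordS i))).
Proof.
by apply: cyclic_gt0; [exact: (ordS_neq _ n3).2|exact: (ordS_neq _ n3).1].
Qed.

Lemma cyclic_prev_gt0 i : 0 < orient (v (ord_pred i)) (v i) (v (ordS i)).
Proof. by rewrite -{2}(ord_predK i) -{3}(ord_predK i) cyclic_next_gt0. Qed.

Lemma cyclic_closure_ge0 i x : closure F x -> 0 <= orient (v i) (v (ordS i)) x.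
Proof.
rewrite cyclic_closure; apply: hull_orient_ge0 => _ [j _ <-].
have [->|ji] := eqVneq j i; first by rewrite orient_base1.
have [->|jSi] := eqVneq j (ordS i); first by rewrite orient_base2.
exact/ltW/cyclic_gt0.
Qed.

Lemma cyclic_next_neq i : v i != v (ordS i).
Proof.
by apply/eqP => e; have := cyclic_next_gt0 i; rewrite -e /orient; lra.
Qed.

Lemma cyclic_inj : injective v.
Proof.
move=> i j vij; apply: contrapT => /eqP ij.
have [jS|jS] := eqVneq j (ordS i).
  by have := cyclic_next_neq i; rewrite -jS vij eqxx.
have := cyclic_gt0 _ jS; rewrite eq_sym ij => /(_ isT).
by rewrite -vij orient_base1 ltxx.
Qed.

End Cyclic.

Lemma cyclic_vertices_mem F n (v : 'I_n -> plane R) m (w : 'I_m -> plane R) k :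
  cyclic_vertices F v -> cyclic_vertices F w -> exists j, w j = v k.
Proof.
move=> Fv Fw; apply: contrapT => now.
(* Both terms are nonnegative on [closure F] and vanish together only at [v k]. If no [w j] were
   [v k], [f] would be positive on the hull of [w], which contains [v k]. *)
pose f x := orient (v (ord_pred k)) (v k) x + orient (v k) (v (ordS k)) x.
suff : 0 < f (v k) by rewrite /f orient_base1 orient_base2 addr0 ltxx.
suff fpos : forall x, hull (range w) x -> 0 < f x.
  by apply: fpos; rewrite -(cyclic_closure Fw); exact: cyclic_vertex_closure.
apply: hull_sub => [_ [j _ <-]|x y a b x0 y0 a0 b0 ab]; last first.
  have -> : f (a *: x + b *: y) = a * f x + b * f y.
    by rewrite /f !orient_conv//; ring.
  have [a00|an0] := eqVneq a 0.
    have b1 : b = 1 by lra.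
    by rewrite a00 b1 mul0r add0r mul1r.
  have {an0}a1 : 0 < a by rewrite lt0r an0.
  by apply: ltr_pwDl; [exact: mulr_gt0|rewrite mulr_ge0// ltW].
have cj : closure F (w j) by exact: cyclic_vertex_closure.
have f1 : 0 <= orient (v (ord_pred k)) (v k) (w j).
  by rewrite -{2}(ord_predK k) (cyclic_closure_ge0 Fv).
have f2 : 0 <= orient (v k) (v (ordS k)) (w j) by exact: (cyclic_closure_ge0 Fv).
rewrite lt0r addr_ge0// andbT /f paddr_eq0//; apply/negP => /andP[/eqP w1 /eqP w2].
apply: now; exists j; apply: two_linesP w1 w2.
by rewrite gt_eqF// (cyclic_prev_gt0 Fv).
Qed.

(** Two enumerations list the same vertices without repetition, so they are permutations of each
    other. *)
Lemma cyclic_barycenter F n (v : 'I_n -> plane R) m (w : 'I_m -> plane R) :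
  cyclic_vertices F v -> cyclic_vertices F w -> barycenter v = barycenter w.
Proof.
move=> Fv Fw.
have vw : perm_eq (codom v) (codom w).
  apply: uniq_perm => [||x].
  - by rewrite map_inj_uniq ?enum_uniq//; exact: cyclic_inj Fv.
  - by rewrite map_inj_uniq ?enum_uniq//; exact: cyclic_inj Fw.
  - apply/codomP/codomP => -[i ->].
    by have [j wj] := cyclic_vertices_mem i Fv Fw; exists j.
  by have [j wj] := cyclic_vertices_mem i Fw Fv; exists j.
have sumE k (u : 'I_k -> plane R) : \sum_(i < k) u i = \sum_(x <- codom u) x.
  by rewrite /codom /image_mem big_map big_enum.
have nm : n = m by have := perm_size vw; rewrite !size_codom !card_ord.
by rewrite /barycenter !sumE (perm_big _ vw) nm.
Qed.

(** If the successors differed, each would lie strictly left of the ray from the common vertex to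
    the other, which [orient_swap] forbids. *)
Lemma cyclic_next F n (v : 'I_n -> plane R) m (w : 'I_m -> plane R) i j :
  cyclic_vertices F v -> cyclic_vertices F w -> v i = w j ->
  v (ordS i) = w (ordS j).
Proof.
move=> Fv Fw vw.
have [k vk] := cyclic_vertices_mem (ordS j) Fw Fv.
have [l wl] := cyclic_vertices_mem (ordS i) Fv Fw.
have [<-|kS] := eqVneq k (ordS i); first by rewrite vk.
have [<-|lS] := eqVneq l (ordS j); first by rewrite wl.
have ki : k != i.
  by apply/eqP => ki; have := cyclic_next_neq Fw j; rewrite -vk ki vw eqxx.
have lj : l != j.
  by apply/eqP => lj; have := cyclic_next_neq Fv i; rewrite -wl lj vw eqxx.
have := cyclic_gt0 Fv ki kS; have := cyclic_gt0 Fw lj lS.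
by rewrite -vw wl vk orient_swap oppr_gt0 => /lt_trans D0 /D0; rewrite ltxx.
Qed.

(** * Faces of the subdivision *)

Section Faces.
Variable T : {fset triangle R}.

Definition corner_seq : seq (plane R) := [seq p | t <- T, p <- corners t].

Definition edge_seq : seq (plane R * plane R) := [seq e | t <- T, e <- edges t].

Lemma size_corner_seq : size corner_seq = (3 * #|` T|)%N.
Proof.
rewrite /corner_seq size_allpairs_dep.
have -> : [seq size (corners t) | t <- T] = nseq (size T) 3%N.
  by elim: (enum_fset T) => //= t s ->.
by rewrite sumn_nseq.
Qed.

Lemma size_edge_seq : size edge_seq = (3 * #|` T|)%N.
Proof.
rewrite /edge_seq size_allpairs_dep.
have -> : [seq size (edges t) | t <- T] = nseq (size T) 3%N.
  by elim: (enum_fset T) => //= t s ->.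
by rewrite sumn_nseq.
Qed.

Lemma bounding_hullE : bounding_hull T = hull [set` corner_seq].
Proof.
congr hull; apply/seteqP; split=> [p [t tT /= pt]|p /=].
  by apply/allpairsPdep; exists t, p.
by move=> /allpairsPdep[t [q [tT qt ->]]]; exists t.
Qed.

Lemma boundary_edges_seq e : boundary_edges T e -> e \in edge_seq.
Proof. by move=> [[t tT et] _]; apply/allpairsPdep; exists t, e. Qed.

(** A degenerate edge is a single point and contains no nondegenerate segment; hence every
    subdivision line is a genuine line. *)
Lemma boundary_edges_neq e : boundary_edges T e -> e.1 != e.2.
Proof.
move=> [_ [x [y [xy sub]]]]; apply: contra xy => /eqP e12.
have segE : segment e.1 e.2 = [set e.2].
  by rewrite /segment e12 setUid hull_set1.
have [xe _] := sub x (sub_hull (or_introl erefl)).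
have [ye _] := sub y (sub_hull (or_intror erefl)).
by rewrite segE in xe ye; rewrite xe ye.
Qed.

Lemma finite_boundary_edges : finite_set (boundary_edges T).
Proof.
apply: sub_finite_set (finite_seq edge_seq) => e; exact: boundary_edges_seq.
Qed.

Let U := (bounding_hull T)° `\` subdivision_lines T.

Lemma open_complement_lines : open U.
Proof.
rewrite /U setDE; apply: openI; first exact: open_interior.
apply: closed_openC.
by apply: closed_bigcup => [|e _]; [exact: finite_boundary_edges|exact: closed_line].
Qed.

Lemma face_sub F : faces T F -> F `<=` U.
Proof. by move=> [x _ <-]; exact: connected_component_sub. Qed.

Lemma face_nbhs F y : faces T F -> U y -> closure F y -> nbhs y F.
Proof.
by move=> [x _ <-] Uy; apply: component_nbhs => //; exact: open_complement_lines.
Qed.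

Lemma face_eq F F' x : faces T F -> faces T F' -> F x -> F' x -> F = F'.
Proof.
move=> [y _ <-] [z _ <-] /same_connected_component -> Fx'.
by rewrite (same_connected_component Fx').
Qed.

Lemma closure_face_sub F : faces T F -> closure F `<=` bounding_hull T.
Proof.
move=> FT; rewrite bounding_hullE.
have /closure_id -> : closed (hull [set` corner_seq]) by exact: hull_seq_closed.
rewrite -bounding_hullE; apply: closureS => x /(face_sub FT)[+ _].
exact: interior_subset.
Qed.

Definition supporting_pair p q :=
  [/\ p \in corner_seq, q \in corner_seq, p != q &
    forall r, r \in corner_seq -> 0 <= orient p q r].

Section Side.
Variables (F : set (plane R)) (n : nat) (v : 'I_n -> plane R) (i : 'I_n).
Hypotheses (FT : faces T F) (Fv : cyclic_vertices F v).

Lemma face_open_triangle :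
  open_triangle (v i) (v (ordS i)) (v (ordS (ordS i))) `<=` closure F.
Proof.
rewrite (cyclic_closure Fv).
by apply: open_triangle_hull; apply: sub_hull; eexists.
Qed.

(** Such a point [x] of the side must be on the border of the bounding hull, for otherwise [F] would
    be a neighbourhood of [x] and cross its own side. A corner strictly right of the side would put
    [x] in the interior. *)
Lemma side_corners_left t : 0 < t < 1 ->
  ~ subdivision_lines T ((1 - t) *: v i + t *: v (ordS i)) ->
  forall r, r \in corner_seq -> 0 <= orient (v i) (v (ordS i)) r.
Proof.
move=> /andP[t0 t1] xL r rT; rewrite leNgt; apply/negP => r0.
set p := v i in xL r0 *; set q := v (ordS i) in xL r0 *.
pose w := v (ordS (ordS i)); have D0 : 0 < orient p q w := cyclic_next_gt0 Fv i.
set x := (1 - t) *: p + t *: q in xL.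
have x0 : orient p q x = 0.
  by rewrite /x orient_conv ?subrK// orient_base1 orient_base2 !mulr0 addr0.
have clx : closure F x.
  rewrite (cyclic_closure Fv); apply: hull_conv; rewrite ?subr_ge0 ?subrK ?ltW//.
    by apply: sub_hull; exists i.
  by apply: sub_hull; exists (ordS i).
have xH : ~ (bounding_hull T)° x.
  move=> xH; have nF : nbhs x F by apply: face_nbhs => //; split.
  have [e e0 Fe] := nbhs_shift (x - w) nF.
  have := cyclic_closure_ge0 Fv i (subset_closure Fe); rewrite -/p -/q.
  have -> : orient p q (x + e *: (x - w)) =
      (1 + e) * orient p q x - e * orient p q w.
    by rewrite /orient /= /GRing.scale /=; ring.
  by rewrite x0 mulr0 sub0r oppr_ge0 leNgt mulr_gt0.
(* Moving [x] a little away from [r] lands it in the open triangle [p q w], inside the hull;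
   [hull_expand_nbhs] carries the neighbourhood back to [x]. The two pairs control the sides [q w]
   and [w p]. *)
apply: xH; have [|e e0 eP] := @affine_gt0 [::
    ((1 - t) * orient p q w, orient q w x - orient q w r);
    (t * orient p q w, orient w p x - orient w p r)].
  move=> u; rewrite !inE => /orP[] /eqP -> /=; last exact: mulr_gt0.
  by rewrite mulr_gt0// subr_gt0.
have ee : 0 < e <= e by rewrite e0 lexx.
rewrite bounding_hullE; apply: (@hull_expand_nbhs _ r x e) => //.
  exact: sub_hull.
rewrite -bounding_hullE.
apply: (@filterS _ _ _ (open_triangle p q w)).
  by move=> y /face_open_triangle/(closure_face_sub FT).
apply: nbhs_open_triangle; split.
- have -> : orient p q (x + e *: (x - r)) =
      (1 + e) * orient p q x - e * orient p q r.
    by rewrite /orient /= /GRing.scale /=; ring.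
  by rewrite x0 mulr0 sub0r -mulrN mulr_gt0// oppr_gt0.
- have -> : orient q w (x + e *: (x - r)) =
      (1 - t) * orient p q w + (orient q w x - orient q w r) * e.
    by rewrite /x /orient /= /GRing.scale /=; ring.
  by apply: (eP (_, _)); rewrite ?inE ?eqxx.
- have -> : orient w p (x + e *: (x - r)) =
      t * orient p q w + (orient w p x - orient w p r) * e.
    by rewrite /x /orient /= /GRing.scale /=; ring.
  by apply: (eP (_, _)); rewrite ?inE ?eqxx ?orbT.
Qed.

(** If no boundary edge spans the line of the side, a generic point of the side avoids all
    subdivision lines. Then all corners are on the left, and [hull_supporting_pair] finds two of
    them on the line. *)
Lemma face_side_line :
  (exists e, [/\ boundary_edges T e, orient e.1 e.2 (v i) = 0 &
     orient e.1 e.2 (v (ordS i)) = 0]) \/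
  (exists p q, [/\ supporting_pair p q, orient p q (v i) = 0 &
     orient p q (v (ordS i)) = 0]).
Proof.
have [|noe] := pselect (exists e, [/\ boundary_edges T e,
  orient e.1 e.2 (v i) = 0 & orient e.1 e.2 (v (ordS i)) = 0]); [by left|right].
have [|t t01 tP] := @generic_point (v i) (v (ordS i))
    [seq e <- edge_seq | `[< boundary_edges T e >]].
  move=> e; rewrite mem_filter => /andP[/asboolP eT _] e1.
  by apply/eqP => e2; apply: noe; exists e.
have left : forall r, [set` corner_seq] r -> 0 <= orient (v i) (v (ordS i)) r.
  apply: (side_corners_left t01) => -[e eT /eqP]; apply/negP; apply: tP.
  by rewrite mem_filter boundary_edges_seq// andbT; apply/asboolP.
have [||p [q [pT qT pq [pqT p0 q0]]]] := hull_supporting_pair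
    (cyclic_next_neq Fv i) _ _ left.
- rewrite -bounding_hullE; apply: (closure_face_sub FT).
  exact: cyclic_vertex_closure.
- rewrite -bounding_hullE; apply: (closure_face_sub FT).
  exact: cyclic_vertex_closure.
by exists p, q; split.
Qed.

End Side.

Lemma face_vertex_ray F n (v : 'I_n -> plane R) i F' m (w : 'I_m -> plane R) j c :
  faces T F -> cyclic_vertices F v -> faces T F' -> cyclic_vertices F' w ->
  v i = w j -> 0 < c -> w (ordS j) = v i + c *: (v (ordS i) - v i) -> F = F'.
Proof.
move=> FT Fv FT' Fw vw c0 wE.
have D0 := cyclic_next_gt0 Fv i.
have := cyclic_next_gt0 Fw j; rewrite -vw => D'0.
have [x [xv xw]] := open_triangles_overlap c0 wE D0 D'0.
have Fx : closure F x by exact: face_open_triangle Fv _ xv.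
(* The overlap point is only known to be in the closures, so it is replaced by a nearby point [y] of
   [F] itself; as [y] avoids the subdivision lines, it belongs to [F'] too. *)
have [y [Fy yw]] := Fx _ (nbhs_open_triangle xw).
have F'y : closure F' y by apply: (face_open_triangle Fw (i := j)); rewrite -vw.
have Uy := face_sub FT Fy.
exact: face_eq FT FT' Fy (nbhs_singleton (face_nbhs FT' Uy F'y)).
Qed.

End Faces.

(** * Counting *)

Section Labels.
Variable T : {fset triangle R}.

(** One partner per corner suffices, since all partners of [p] lie on one line through [p]. The
    value is [p] itself when there is no partner. *)
Definition support p : plane R := xget p [set q | supporting_pair T p q].

Definition line_seq : seq (plane R * plane R) :=
  edge_seq T ++ [seq (p, support p) | p <- corner_seq T].

Lemma size_line_seq : size line_seq = (6 * #|` T|)%N.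
Proof.
by rewrite size_cat size_map size_edge_seq size_corner_seq -mulnDl.
Qed.

Lemma supporting_pair_support p q x : supporting_pair T p q ->
  orient p q x = 0 -> p != support p /\ orient p (support p) x = 0.
Proof.
move=> pq x0; have [pT qT npq pqT] := pq.
have [p'T sT nps psT] : supporting_pair T p (support p).
  by rewrite /support; case: xgetP => // /(_ q).
split => //; apply: (line_collinear npq) x0; first exact: orient_base1.
(* Each of [q] and [support p] is weakly left of the ray from [p] to the other, so the three points
   are collinear. *)
by apply/eqP; rewrite eq_le pqT// andbT -oppr_ge0 -orient_swap psT.
Qed.

Lemma side_line_mem F n (v : 'I_n -> plane R) i :
  faces T F -> cyclic_vertices F v ->
  exists e, [/\ e \in line_seq, e.1 != e.2, orient e.1 e.2 (v i) = 0 &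
    orient e.1 e.2 (v (ordS i)) = 0].
Proof.
move=> FT Fv; have [[e [eT e0 e1]]|[p [q [pq p0 q0]]]] := face_side_line i FT Fv.
  exists e; split => //; last exact: boundary_edges_neq eT.
  by rewrite mem_cat boundary_edges_seq.
exists (p, support p); have [ps s0] := supporting_pair_support pq p0.
have [_ s1] := supporting_pair_support pq q0; split => //.
by rewrite mem_cat map_f ?orbT//; case: pq.
Qed.

(** The label holds the line of the side, the line of the preceding side, and whether the side runs
    in the direction of the first pair. *)
Definition side_label (l : (plane R * plane R) * (plane R * plane R) * bool)
    (t : triangle R) : Prop :=
  exists F n (v : 'I_n -> plane R) i,
  [/\ faces T F, cyclic_vertices F v, t = (barycenter v, v i, v (ordS i)),
      [/\ l.1.1.1 != l.1.1.2, orient l.1.1.1 l.1.1.2 (v i) = 0 &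
       exists c, [/\ v (ordS i) = v i + c *: (l.1.1.2 - l.1.1.1), c != 0 &
         (0 < c) = l.2]] &
      [/\ l.1.2.1 != l.1.2.2, orient l.1.2.1 l.1.2.2 (v (ord_pred i)) = 0 &
       orient l.1.2.1 l.1.2.2 (v i) = 0]].

Lemma side_label_inj l t t' : side_label l t -> side_label l t' -> t = t'.
Proof.
case: l => [[e e'] b].
move=> [F [n [v [i [FT Fv -> /= [ee vi0 [c [vS c0 cb]]] [ee' vp0 vi0']]]]]].
move=> [F' [m [w [j [FT' Fw -> /= [_ wj0 [d [wS d0 db]]] [_ wp0 wj0']]]]]].
have vw : v i = w j.
  apply/esym/(@two_linesP (v (ord_pred i)) _ (v (ordS i))).
  - by rewrite gt_eqF// (cyclic_prev_gt0 Fv).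
  - exact: line_collinear ee' vp0 vi0' wj0'.
  - apply: (line_collinear ee vi0 _ wj0).
    rewrite vS; apply: etrans vi0.
    by rewrite /orient /= /GRing.scale /=; ring.
(* The ratio of the two sides as vectors along the common line; equal direction bits make it
   positive, as [face_vertex_ray] requires. *)
have cd0 : 0 < d / c.
  case: b cb db => [c1 d1|c1 d1]; first exact: divr_gt0.
  rewrite -mulrNN -invrN divr_gt0// oppr_gt0 lt_neqAle ?c0 ?d0 leNgt.
    by rewrite d1.
  by rewrite c1.
have FF' : F = F'.
  apply: (face_vertex_ray FT Fv FT' Fw vw cd0).
  have -> : v (ordS i) - v i = c *: (e.2 - e.1) by rewrite vS addrC addKr.
  by rewrite wS -vw scalerA divfK.
rewrite -{}FF' in Fw.
by rewrite (cyclic_barycenter Fv Fw) (cyclic_next Fv Fw vw) vw.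
Qed.

Lemma spatial_triangulation_label t : spatial_triangulation T t ->
  exists2 l, l \in [seq (u, fwd) |
      u <- [seq (e, e') | e <- line_seq, e' <- line_seq],
      fwd <- [:: true; false]] & side_label l t.
Proof.
move=> [F [n [v [i [FT Fv _ ->]]]]].
have [e [eL ee e1 e2]] := side_line_mem i FT Fv.
have [e' [eL' ee' e1' e2']] := side_line_mem (ord_pred i) FT Fv.
rewrite ord_predK in e2'.
have [a va] := on_lineP ee e1; have [b vb] := on_lineP ee e2.
exists (e, e', 0 < b - a).
  by rewrite !allpairs_f// !inE; case: (0 < b - a).
exists F, n, v, i; split => //; split => //; exists (b - a); split => //.
  by rewrite vb va scalerBl -addrA [a *: _ + _]addrC subrK.
apply: contra (cyclic_next_neq Fv i); rewrite subr_eq0 => /eqP ba.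
by rewrite va vb ba.
Qed.

End Labels.

End Geometry.

Theorem mainTheorem2 :
  exists C : nat,
    forall (R : realType) (m : nat) (T : {fset triangle R}),
      #|` T|%fset = m ->
      (forall t p, t \in T -> p \in corners t -> algebraic_point p) ->
      fully_two_dimensional T ->
      finite_set (spatial_triangulation T) /\
      (#|` fset_set (spatial_triangulation T)|%fset <= C * m ^ 2)%N.
Proof.
(* 72 is 2 * 6 ^ 2: ordered pairs from the [6 * m] listed lines, times two directions. *)
exists 72 => R m T Tm _ _.
have [finT leT] := card_le_labels
  (@spatial_triangulation_label _ T) (@side_label_inj _ T).
split=> //; apply: leq_trans leT _.
by rewrite !size_allpairs /= size_line_seq Tm; lia.
Qed.
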